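(* Let $n\geq 3$, $j\in\{2,\dots,n-1\}$, $p\in[0,1)$ and $\lambda\in(0,1)$. Then there exist origin-symmetric convex bodies $K$ and $L$ in $\mathbb R^n$ such that $$V_j\big((1-\lambda)\cdot K+_p\lambda\cdot L\big)<V_j(K)^{1-\lambda}V_j(L)^{\lambda}\leq \Big((1-\lambda)V_j(K)^{p/j}+\lambda V_j(L)^{p/j}\Big)^{j/p},$$ where for $p=0$ the right-most expression is understood as $V_j(K)^{1-\lambda}V_j(L)^\lambda$.
   Context: A convex body is a compact convex subset of $\mathbb R^n$ with nonempty interior; it is (origin-)symmetric if $K=-K$. The support function is $h_K(x)=\max_{y\in K}\langle x,y\rangle$. For a continuous $f:\mathbb S^{n-1}\to(0,\infty)$, its Wulff shape $W(f)$ is the largest convex body whose support function is $\le f$ on $\mathbb S^{n-1}$. For convex bodies $K,L$ containing the origin in their interior, $\lambda\in(0,1)$, the $L_p$-Minkowski combination is $(1-\lambda)\cdot K+_p\lambda\cdot L:=W\big(((1-\lambda)h_K^p+\lambda h_L^p)^{1/p}\big)$ for $p\neq 0$ and $W(h_K^{1-\lambda}h_L^\lambda)$ for $p=0$. The intrinsic volumes $V_0(K),\dots,V_n(K)$ are defined by the Steiner formula $V_n(K+\rho B_2^n)=\sum_{j=0}^n\rho^{n-j}\kappa_{n-j}V_j(K)$ for $\rho>0$, where $V_n$ is volume, $B_2^n$ the Euclidean unit ball and $\kappa_d$ the volume of the $d$-dimensional unit ball. *)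

(* Defs.v *)
From HB Require Import structures.
From mathcomp Require Import all_boot all_order all_algebra.
From mathcomp Require Import all_classical all_reals all_analysis.
From Stdlib Require Import ClassicalEpsilon.
Set Implicit Arguments. Unset Strict Implicit. Unset Printing Implicit Defensive.
Import Order.TTheory GRing.Theory Num.Theory.
Import numFieldNormedType.Exports.
Local Open Scope classical_set_scope.
Local Open Scope ring_scope.

Section ConvexGeometry.
Variable R : realType.

Definition dotv (n : nat) (x y : 'rV[R]_n) : R := \sum_(i < n) x 0 i * y 0 i.

Definition unit_ball (n : nat) : set 'rV[R]_n := [set x | dotv x x <= 1].
Definition unit_sphere (n : nat) : set 'rV[R]_n := [set u | dotv u u = 1].

(* n-dimensional Lebesgue measure, defined as an iterated Lebesgue integral
   (Tonelli): vol_0 A = 1 iff the unique point of R^0 is in A,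
   vol_{m+1} A = \int_R vol_m (section of A at first coordinate t) dt. *)
Fixpoint volume (n : nat) : set 'rV[R]_n -> \bar R :=
  match n return set 'rV[R]_n -> \bar R with
  | 0 => fun A => if `[< A 0 >] then 1%E else 0%E
  | m.+1 => fun A =>
      (\int[@lebesgue_measure R]_(t in [set: R])
          volume [set y : 'rV[R]_m | A (row_mx (\row_(k < 1) t) y)])%E
  end.

Definition kappa (d : nat) : R := fine (volume (@unit_ball d)).

Definition convex_set (n : nat) (K : set 'rV[R]_n) : Prop :=
  forall x y t, K x -> K y -> 0 <= t <= 1 -> K (t *: x + (1 - t) *: y).

Definition convex_body (n : nat) (K : set 'rV[R]_n) : Prop :=
  convex_set K /\ compact K /\ (interior K !=set0).

Definition origin_symmetric (n : nat) (K : set 'rV[R]_n) : Prop :=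
  forall x, K x -> K (- x).

Definition support_fun (n : nat) (K : set 'rV[R]_n) (x : 'rV[R]_n) : R :=
  sup [set dotv x y | y in K].

(* Wulff shape (Alexandrov body) of f : S^{n-1} -> (0,oo): the largest
   convex body whose support function is <= f on S^{n-1}, i.e.
   W(f) = {x | <x,u> <= f(u) for all u in S^{n-1}}. *)
Definition wulff (n : nat) (f : 'rV[R]_n -> R) : set 'rV[R]_n :=
  [set x | forall u, @unit_sphere n u -> dotv x u <= f u].

Definition Lp_comb (n : nat) (p lam : R) (K L : set 'rV[R]_n) : set 'rV[R]_n :=
  if p == 0 then
    wulff (fun u => (support_fun K u `^ (1 - lam)) * (support_fun L u `^ lam))
  else
    wulff (fun u => ((1 - lam) * support_fun K u `^ p
                     + lam * support_fun L u `^ p) `^ (p^-1)).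

Definition parallel_body (n : nat) (K : set 'rV[R]_n) (rho : R) : set 'rV[R]_n :=
  [set z | exists x b, K x /\ @unit_ball n b /\ z = x + rho *: b].

Definition steiner_coeffs (n : nat) (K : set 'rV[R]_n) (V : nat -> R) : Prop :=
  forall rho : R, 0 < rho ->
    volume (parallel_body K rho) =
      (\sum_(j < n.+1) rho ^+ (n - j) * kappa (n - j) * V j)%:E.

(* intrinsic volumes V_0(K), ..., V_n(K): the (unique) coefficients in the
   Steiner formula *)
Definition intrinsic_volume (n : nat) (K : set 'rV[R]_n) (j : nat) : R :=
  epsilon (inhabits (fun _ : nat => 0)) (steiner_coeffs K) j.

End ConvexGeometry.

(* Main.v *)
(* Both bodies are boxes [prod_i [-a_i, a_i]].  Slicing shows that a box
   satisfies the Steiner formula with [V_j] equal to [2 ^ j] times the [j]-th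
   elementary symmetric function of the [a_i].  Since the mean [M] defining the
   [L_p] combination is homogeneous and superadditive for [p <= 1], the
   combination of two boxes is the box of the means [M(a_i, b_i)].
   With [j - 1] entries equal to [1] and the others equal to [d * w_i], the
   elementary symmetric function is [d * (sum_i w_i) + O(d ^ 2)].  For
   [w = (1, r, r, ..., r)] and [w = (r, r, ..., r, 1)] the sum is at least [1],
   whereas for the means of these two it tends to [M(1, 0) + M(0, 1)] as [r]
   tends to [0], and this limit is below [1] because [p < 1]. *)
Require Import Defs.
From mathcomp Require Import all_boot all_order all_algebra.
From mathcomp Require Import all_classical all_reals all_analysis.
From mathcomp Require Import measurable_realfun ring lra zify.
Import Order.TTheory GRing.Theory Num.Theory.
Import numFieldNormedType.Exports.
Local Open Scope classical_set_scope.
Local Open Scope ring_scope.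
Set Implicit Arguments.
Unset Strict Implicit.

Lemma rV_ind (T : Type) (P : forall n, 'rV[T]_n -> Prop) :
  (forall w : 'rV_0, P 0%N w) ->
  (forall n (a : 'rV_1) (w : 'rV_n), P n w -> P (1 + n)%N (row_mx a w)) ->
  forall n (w : 'rV_n), P n w.
Proof.
move=> P0 PS; elim=> [|n IHn] w; first exact: P0.
by rewrite -[w](@hsubmxK _ 1 1 n); exact: PS.
Qed.

Lemma gt0_roots_poly_eq0 (R : numDomainType) (p : {poly R}) :
  (forall x, 0 < x -> p.[x] = 0) -> p = 0.
Proof.
move=> p0; pose rs := [seq k.+1%:R : R | k <- iota 0 (size p)].
apply: (@roots_geq_poly_eq0 _ p rs); last by rewrite size_map size_iota.
  by apply/allP => _ /mapP[k _ ->]; rewrite rootE p0.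
by rewrite map_inj_uniq ?iota_uniq// => k l /eqP; rewrite eqr_nat eqSS => /eqP.
Qed.

Section ElementarySymmetric.
Context {R : comNzRingType}.

Definition elemsym (n j : nat) (w : 'rV[R]_n) : R :=
  (\prod_(i < n) (1 + w 0 i *: 'X))`_j.

Lemma elemsym_row_mx m n j (v : 'rV_m) (w : 'rV_n) :
  elemsym j (row_mx v w) = \sum_(i < j.+1) elemsym i v * elemsym (j - i) w.
Proof.
rewrite /elemsym big_split_ord -coefM.
congr (polyseq _)`_j; congr *%R; apply: eq_bigr => i _.
  by rewrite row_mxEl.
by rewrite row_mxEr.
Qed.

Lemma elemsym_dim0 j (w : 'rV_0) : elemsym j w = (j == 0)%:R.
Proof. by rewrite /elemsym big_ord0 coef1. Qed.

Lemma elemsym0 n (w : 'rV_n) : elemsym 0 w = 1.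
Proof.
rewrite /elemsym coef0_prod big1// => i _.
by rewrite coefD coef1 coefZ coefX mulr0 addr0.
Qed.

Lemma elemsym_cons n j (a : 'rV_1) (w : 'rV_n) :
  elemsym j.+1 (row_mx a w) = elemsym j.+1 w + a 0 0 * elemsym j w.
Proof.
rewrite {1}/elemsym (@big_split_ord _ _ _ 1 n) big_ord1 row_mxEl.
under eq_bigr do rewrite row_mxEr.
by rewrite /= mulrDl mul1r coefD -scalerAl coefZ coefXM.
Qed.

Lemma elemsym1 n (w : 'rV_n) : elemsym 1 w = \sum_i w 0 i.
Proof.
elim/rV_ind: w => [w|{}n a w IHw]; first by rewrite elemsym_dim0 big_ord0.
rewrite elemsym_cons elemsym0 mulr1 IHw (@big_split_ord _ _ _ 1 n) big_ord1.
rewrite addrC row_mxEl; congr (_ + _).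
by apply: eq_bigr => i _; rewrite row_mxEr.
Qed.

Lemma elemsym_gt n j (w : 'rV_n) : (n < j)%N -> elemsym j w = 0.
Proof.
elim/rV_ind: w j => [w|{}n a w IHw] [|j]// nj; first by rewrite elemsym_dim0.
by rewrite elemsym_cons !IHw ?mulr0 ?addr0//; exact: ltnW.
Qed.

Lemma elemsymZ n j c (w : 'rV_n) : elemsym j (c *: w) = c ^+ j * elemsym j w.
Proof.
elim/rV_ind: w j => [w|{}n a w IHw] [|j]; rewrite ?elemsym0 ?mulr1//.
  by rewrite !elemsym_dim0 mulr0.
by rewrite scale_row_mx !elemsym_cons !IHw mxE exprS; ring.
Qed.

Lemma elemsym_const1 n j : elemsym j (const_mx 1 : 'rV_n) = 'C(n, j)%:R.
Proof.
elim: n j => [|n IHn] [|j]; rewrite ?elemsym0 ?bin0//.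
  by rewrite elemsym_dim0.
rewrite -[const_mx 1](@row_mx_const _ 1 1 n).
by rewrite elemsym_cons !IHn mxE mul1r -natrD binS.
Qed.

Definition pad1 k n (w : 'rV[R]_n) : 'rV[R]_(k + n) := row_mx (const_mx 1) w.

Lemma elemsym_pad1 k n (w : 'rV_n) d :
  elemsym k.+1 (pad1 k (d *: w)) =
  d * \sum_(i < k.+1) 'C(k, i)%:R * elemsym i.+1 w * d ^+ i.
Proof.
rewrite elemsym_row_mx big_ord_recr/= elemsym_const1 bin_small// mul0r addr0.
rewrite (reindex_inj rev_ord_inj) mulr_sumr/=; apply: eq_bigr => i _.
have le_ik : (i <= k)%N by rewrite -ltnS.
rewrite elemsym_const1 elemsymZ subSS bin_sub// subSn ?leq_subr// subKn// exprS.
by ring.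
Qed.

End ElementarySymmetric.

Lemma elemsym_ge0 (R : numDomainType) n j (w : 'rV[R]_n) :
  (forall i, 0 <= w 0 i) -> 0 <= elemsym j w.
Proof.
elim/rV_ind: w j => [w|{}n a w IHw] [|j] aw0; rewrite ?elemsym0 ?ler01//.
  by rewrite elemsym_dim0.
have a0 : 0 <= a 0 0 by have := aw0 (lshift n 0); rewrite row_mxEl.
have w0 i : 0 <= w 0 i by have := aw0 (rshift 1 i); rewrite row_mxEr.
by rewrite elemsym_cons addr_ge0 ?mulr_ge0 ?IHw.
Qed.

Lemma pad1_gt0 (R : numDomainType) k n (w : 'rV[R]_n) :
  (forall i, 0 < w 0 i) -> forall i, 0 < pad1 k w 0 i.
Proof.
move=> w0 i; rewrite /pad1; case: (split_ordP i) => l ->.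
  by rewrite row_mxEl mxE.
by rewrite row_mxEr.
Qed.

Lemma elemsym_pad1_ge (R : numDomainType) k n (w : 'rV[R]_n) d :
  (forall i, 0 <= w 0 i) -> 0 <= d ->
  d * \sum_i w 0 i <= elemsym k.+1 (pad1 k (d *: w)).
Proof.
move=> w0 d0; rewrite elemsym_pad1 ler_wpM2l// big_ord_recl/=.
rewrite bin0 elemsym1 mul1r mulr1 lerDl sumr_ge0// => i _.
by rewrite !mulr_ge0 ?exprn_ge0 ?elemsym_ge0.
Qed.

Lemma cvg_elemsym_pad1 (R : realType) k n (w : 'rV[R]_n) :
  d^-1 * elemsym k.+1 (pad1 k (d *: w)) @[d --> 0^'+] --> \sum_i w 0 i.
Proof.
pose p := \poly_(i < k.+1) ('C(k, i)%:R * elemsym i.+1 w).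
have <- : p.[0] = \sum_i w 0 i.
  by rewrite horner_coef0 coef_poly bin0 mul1r elemsym1.
have : p.[d] @[d --> 0^'+] --> p.[0].
  by apply: cvg_at_right_filter; exact: continuous_horner.
apply: cvg_trans; apply: near_eq_cvg; near=> d.
have d0 : d != 0 by rewrite gt_eqF.
by rewrite elemsym_pad1 mulKf// horner_poly.
Unshelve. all: by end_near. Qed.

Lemma near_elemsym_pad1_lt (R : realType) k n (w : 'rV[R]_n) c :
  \sum_i w 0 i < c ->
  \forall d \near 0^'+, elemsym k.+1 (pad1 k (d *: w)) < d * c.
Proof.
move=> sum_lt; near=> d; have d0 : 0 < d by [].
rewrite -ltr_pdivrMl//; near: d.
by apply: cvgr_lt sum_lt; exact: cvg_elemsym_pad1.
Unshelve. all: by end_near. Qed.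

Section ChangeOfVariables.
Context {R : realType}.
Local Notation mu := (@lebesgue_measure R).

Lemma preimage_affine_itvoc (c e a b : R) : 0 < c ->
  (fun t => c * t + e) @^-1` `]a, b] = `](a - e) / c, (b - e) / c]%classic.
Proof.
move=> c0; apply/seteqP; split=> t /=;
  by rewrite !in_itv/= ltr_pdivrMr// ler_pdivlMr// ltrBlDr lerBrDr (mulrC t).
Qed.

Lemma measurable_affine (c e : R) :
  measurable_fun [set: R] (fun t : R => c * t + e).
Proof. by apply: measurable_funD => //; exact: measurable_funM. Qed.

Lemma lebesgue_measure_affine (c e : R) (c0 : 0 < c) (A : set R) :
  measurable A -> pushforward (mscale (NngNum (ltW c0)) mu)
    (fun t : R => c * t + e : measurableTypeR R) A = mu A.
Proof.
move=> mA; apply/esym/lebesgue_measure_unique => //=.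
  exact: measurable_affine.
move=> _ _ [[a b]] _ <-.
rewrite /pushforward preimage_affine_itvoc// /mscale/= !lebesgue_measure_itv/=.
rewrite !lte_fin ltr_pM2r ?invr_gt0// ltrD2r.
case: ifPn => _; last by rewrite mule0.
by rewrite -!EFinB -EFinM; congr EFin; field; rewrite gt_eqF.
Qed.

Lemma ge0_integral_affine (c e : R) (D : set R) (f : R -> \bar R) : 0 < c ->
  measurable D -> measurable_fun [set: R] f -> (forall t, 0 <= f t)%E ->
  (\int[mu]_(t in D) f t =
   c%:E * \int[mu]_(t in (fun t => c * t + e)%R @^-1` D) f (c * t + e)%R)%E.
Proof.
move=> c0 mD mf f0.
have maff := measurable_affine c e.
have mDaff : measurable ((fun t => c * t + e) @^-1` D).
  by rewrite -[X in measurable X]setTI; exact: maff.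
have mfaff : measurable_fun [set: R] (fun t => f (c * t + e)).
  exact: measurableT_comp mf maff.
rewrite -(ge0_integral_mscale _ _ (NngNum (ltW c0)))//=; last first.
  exact: measurable_funTS.
apply: etrans (@ge0_integral_pushforward _ _ (measurableTypeR R)
  (measurableTypeR R) R _ maff _ D f mD _ _) => //; last first.
  exact: measurable_funTS.
by apply: eq_measure_integral => A mA _; exact/esym/lebesgue_measure_affine.
Qed.

Lemma ge0_integral_shift (e : R) (D : set R) (f : R -> \bar R) :
  measurable D -> measurable_fun [set: R] f -> (forall t, 0 <= f t)%E ->
  (\int[mu]_(t in (fun t => t + e)%R @^-1` D) f (t + e)%R =
   \int[mu]_(t in D) f t)%E.
Proof.
move=> mD mf f0; rewrite [RHS](ge0_integral_affine e ltr01)// mul1e.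
have -> : (fun t => 1 * t + e) = (fun t => t + e).
  by apply/funext => t; rewrite mul1r.
by apply: eq_integral => t _; rewrite mul1r.
Qed.

Lemma ge0_integral_itv_split (a b c : itv_bound R) (f : R -> \bar R) :
  (a <= c)%O -> (c <= b)%O ->
  measurable_fun [set: R] f -> (forall t, 0 <= f t)%E ->
  (\int[mu]_(t in [set` Interval a b]) f t =
   \int[mu]_(t in [set` Interval a c]) f t +
   \int[mu]_(t in [set` Interval c b]) f t)%E.
Proof.
move=> ac cb mf f0.
rewrite (itv_bndbnd_setU ac cb) ge0_integral_setU//.
  exact: measurable_funTS.
apply/disj_setPS => t [] /=; rewrite !itv_boundlr => /andP[_ tc] /andP[ct _].
by have := le_trans tc ct; rewrite bnd_simp ltxx.
Qed.

Lemma ge0_integral_even (f : R -> \bar R) :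
  measurable_fun [set: R] f -> (forall t, 0 <= f t)%E ->
  (forall t, f (- t) = f t) ->
  (\int[mu]_t f t =
   \int[mu]_(t in `]0%R, +oo[) f t + \int[mu]_(t in `]0%R, +oo[) f t)%E.
Proof.
move=> mf f0 fN; rewrite -set_itvNyy.
rewrite (ge0_integral_itv_split (c := BRight 0))//; congr (_ + _)%E.
rewrite integral_itv_obnd_cbnd; last exact: measurable_funTS.
rewrite ge0_integration_by_substitution0//.
by apply: eq_integral => t _; rewrite fN.
Qed.

End ChangeOfVariables.

Section DistanceToSegment.
Context {R : realType}.
Local Notation mu := (@lebesgue_measure R).

Definition dist_seg (a t : R) : R := Num.max 0 (`|t| - a).

Lemma dist_seg_ge0 a t : 0 <= dist_seg a t.
Proof. by rewrite le_max lexx. Qed.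

Lemma dist_seg_le a x y : `|x| <= a -> dist_seg a (x + y) <= `|y|.
Proof.
by move=> xa; have := ler_normD x y; rewrite ge_max normr_ge0/=; lra.
Qed.

Lemma measurable_dist_seg a : measurable_fun [set: R] (dist_seg a).
Proof. by apply: measurable_maxr => //; exact: measurable_funB. Qed.

Definition clamp (a t : R) : R := Num.max (- a) (Num.min t a).

Lemma norm_clamp a t : 0 <= a -> `|clamp a t| <= a.
Proof.
move=> a0; rewrite ler_norml le_max lexx/= ge_max ge_min lexx orbT andbT.
by lra.
Qed.

Lemma sqr_sub_clamp a t : 0 <= a -> (t - clamp a t) ^+ 2 = dist_seg a t ^+ 2.
Proof.
move=> a0; rewrite /clamp /dist_seg.
have [ta|ta] := leP t a; last by rewrite max_r ?gtr0_norm ?max_r//; lra.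
have [at0|ta0] := leP (- a) t.
  by rewrite max_l ?subrr// subr_le0 ler_norml at0.
by rewrite ltr0_norm ?max_r; [ring|lra|lra].
Qed.

Lemma ge0_integral_dist_seg (a : R) (g : R -> \bar R) : 0 <= a ->
  measurable_fun [set: R] g -> (forall t, (0 <= g t)%E) ->
  (\int[mu]_t g (dist_seg a t) = (2 * a)%:E * g 0%R + \int[mu]_t g `|t|%R)%E.
Proof.
move=> a0 mg g0.
have mgn : measurable_fun [set: R] (fun t : R => g `|t|).
  exact: measurableT_comp.
have mgd : measurable_fun [set: R] (fun t => g (dist_seg a t)).
  by apply: measurableT_comp => //; exact: measurable_dist_seg.
have inside : (\int[mu]_(t in `]0%R, a]) g (dist_seg a t) = a%:E * g 0%R)%E.
  rewrite (eq_integral (cst (g 0%R))) => [|t]; last first.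
    rewrite inE/= in_itv/= => /andP[t0 ta].
    by rewrite /dist_seg gtr0_norm// max_l// subr_le0.
  rewrite integral_cst//= lebesgue_measure_itv/= lte_fin muleC.
  by congr (_ * _)%E; case: ifPn => aa; rewrite -?EFinB; congr EFin; lra.
have outside : (\int[mu]_(t in `]a, +oo[) g (dist_seg a t) =
    \int[mu]_(t in `]0%R, +oo[) g `|t|%R)%E.
  rewrite -[RHS](ge0_integral_shift (- a))//.
  rewrite (_ : _ @^-1` _ = `]a, +oo[%classic); last first.
    by apply/seteqP; split=> t /=; rewrite !in_itv/= !andbT; lra.
  apply: eq_integral => t; rewrite inE/= in_itv/= andbT => ta; congr g.
  by rewrite /dist_seg !gtr0_norm ?max_r; lra.
rewrite !ge0_integral_even// => [|t|t]; last 2 first.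
- by rewrite normrN.
- by rewrite /dist_seg normrN.
rewrite (ge0_integral_itv_split (c := BRight a))//.
by rewrite inside outside addeACA -ge0_muleDl// -EFinD mulr_natl mulr2n.
Qed.

End DistanceToSegment.

Section DotProduct.
Context {R : realType}.

Lemma dotv_dim1 (x y : 'rV[R]_1) : dotv x y = x 0 0 * y 0 0.
Proof. by rewrite /dotv big_ord1. Qed.

Lemma dotv_row_mx m n (x x' : 'rV[R]_m) (y y' : 'rV[R]_n) :
  dotv (row_mx x y) (row_mx x' y') = dotv x x' + dotv y y'.
Proof.
rewrite /dotv big_split_ord; congr (_ + _); apply: eq_bigr => i _.
  by rewrite !row_mxEl.
by rewrite !row_mxEr.
Qed.

Lemma dotvZ n c (x : 'rV[R]_n) : dotv (c *: x) (c *: x) = c ^+ 2 * dotv x x.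
Proof.
by rewrite /dotv mulr_sumr; apply: eq_bigr => i _; rewrite !mxE; ring.
Qed.

Lemma dotv_delta n (x : 'rV[R]_n) c i : dotv x (c *: delta_mx 0 i) = c * x 0 i.
Proof.
rewrite /dotv (bigD1 i)//= !mxE !eqxx mulr1 mulrC big1 ?addr0// => k ki.
by rewrite !mxE (negbTE ki) andbF !mulr0.
Qed.

End DotProduct.

Section RadiusPower.
Context {R : realType}.

(* [s] is a squared radius.  The value is [0] for [s < 0] even when [d = 0], so
   that [kappa R d * radius_pow d s] is also the volume of an empty ball. *)
Definition radius_pow (d : nat) (s : R) : R := (0 <= s)%R%:R * Num.sqrt s ^+ d.

Lemma radius_pow_ge0 d s : 0 <= radius_pow d s.
Proof. by rewrite mulr_ge0 ?exprn_ge0 ?sqrtr_ge0. Qed.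

Lemma radius_pow_lt0 d s : s < 0 -> radius_pow d s = 0.
Proof. by rewrite /radius_pow leNgt => ->; rewrite mul0r. Qed.

Lemma radius_powZ d c s : 0 < c ->
  radius_pow d (c ^+ 2 * s) = c ^+ d * radius_pow d s.
Proof.
move=> c0; rewrite /radius_pow pmulr_rge0 ?exprn_gt0// mulrCA -exprMn.
by rewrite sqrtrM ?sqr_ge0// sqrtr_sqr gtr0_norm.
Qed.

Lemma radius_pow1 d : radius_pow d 1 = 1.
Proof. by rewrite /radius_pow ler01 sqrtr1 expr1n mulr1. Qed.

Lemma radius_powS0 d : radius_pow d.+1 0 = 0.
Proof. by rewrite /radius_pow sqrtr0 expr0n mulr0. Qed.

Lemma radius_pow_sqr d r : 0 < r -> radius_pow d (r ^+ 2) = r ^+ d.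
Proof.
by move=> r0; rewrite -[r ^+ 2]mulr1 radius_powZ// radius_pow1 mulr1.
Qed.

Lemma ler_radius_pow d : {homo radius_pow d : s t / s <= t}.
Proof.
move=> s t st; rewrite ler_pM ?exprn_ge0 ?sqrtr_ge0//.
  by rewrite ler_nat; case: leP => // s0; rewrite (le_trans s0 st).
by rewrite lerXn2r ?nnegrE ?sqrtr_ge0// ler_wsqrtr.
Qed.

Lemma measurable_radius_pow_slice d s :
  measurable_fun [set: R] (fun t => (radius_pow d (s - t ^+ 2))%:E).
Proof.
apply/measurable_EFinP; apply: (@measurableT_comp _ _ _ _ _ _ (radius_pow d)).
  by apply: nondecreasing_measurable => //; exact: ler_radius_pow.
by apply: measurable_funB => //; exact: measurable_funX.
Qed.

End RadiusPower.

Section BallVolume.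
Context {R : realType}.
Local Notation mu := (@lebesgue_measure R).

Lemma volume_ge0 d (A : set 'rV[R]_d) : (0 <= volume A)%E.
Proof.
elim: d A => [|d IHd] A /=; first by case: ifP => _; rewrite ?lee01.
by apply: integral_ge0 => t _; exact: IHd.
Qed.

Lemma kappa_ge0 d : 0 <= kappa R d.
Proof. exact/fine_ge0/volume_ge0. Qed.

Definition slice_integral (d : nat) : \bar R :=
  (\int[mu]_t (radius_pow d (1 - t ^+ 2))%:E)%E.

Lemma slice_integral_lty d : (slice_integral d < +oo)%E.
Proof.
have le_indic (t : R) : radius_pow d (1 - t ^+ 2) <= \1_(`[-1, 1]) t.
  have [t1|t1] := leP (t ^+ 2) 1; last by rewrite radius_pow_lt0 ?subr_lt0.
  have -> : \1_(`[-1, 1]) t = 1 :> R.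
    rewrite indicE mem_set//= in_itv/= -ler_norml.
    by rewrite -(@expr_le1 _ 2)// real_normK ?num_real.
  rewrite -[leRHS](radius_pow1 d) ler_radius_pow// gerBl.
  exact: sqr_ge0.
apply: (@le_lt_trans _ _ (\int[mu]_t (\1_(`[(-1)%R, 1%R]) t)%:E)%E).
  apply: ge0_le_integral => //.
  - by move=> t _; rewrite lee_fin radius_pow_ge0.
  - exact: measurable_radius_pow_slice.
  - by apply/measurable_EFinP; exact: measurable_indic.
  - by move=> t _; rewrite lee_fin.
rewrite integral_indic//= setIT lebesgue_measure_itv/= lte_fin.
by case: ifP => _; rewrite ?ltry// -EFinD ltry.
Qed.

Lemma slice_integral_gt0 d : (0 < slice_integral d)%E.
Proof.
have ge_cst (t : R) : t \in `[0, 2^-1] ->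
    2^-1 ^+ d <= radius_pow d (1 - t ^+ 2).
  rewrite in_itv/= => /andP[t0 t1].
  by rewrite -radius_pow_sqr ?invr_gt0// ler_radius_pow//; nra.
apply: (@lt_le_trans _ _
  (\int[mu]_(t in `[0%R, 2^-1%R]) (cst (2^-1 ^+ d)%:E) t)%E).
  rewrite integral_cst//= lebesgue_measure_itv/= lte_fin invr_gt0 ltr0n.
  by rewrite -EFinD -EFinM lte_fin subr0 mulr_gt0// exprn_gt0.
apply: (@le_trans _ _ (\int[mu]_(t in `[0%R, 2^-1%R])
    (radius_pow d (1 - t ^+ 2))%:E)%E).
  apply: ge0_le_integral => //.
  - by move=> t _; rewrite lee_fin exprn_ge0.
  - by apply: measurable_funTS; exact: measurable_radius_pow_slice.
apply: ge0_subset_integral => //.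
- exact: measurable_radius_pow_slice.
- by move=> t _; rewrite lee_fin radius_pow_ge0.
Qed.

Lemma slice_integral_fin_num d : slice_integral d \is a fin_num.
Proof.
by rewrite ge0_fin_numE ?slice_integral_lty// ltW// slice_integral_gt0.
Qed.

Lemma integral_radius_pow d s :
  (\int[mu]_t (radius_pow d (s - t ^+ 2))%:E =
   slice_integral d * (radius_pow d.+1 s)%:E)%E.
Proof.
have [s0|s0|->] := ltgtP s 0.
- rewrite radius_pow_lt0// mule0; apply: integral0_eq => t _.
  by rewrite radius_pow_lt0//; have := sqr_ge0 t; lra.
- pose c := Num.sqrt s; have c0 : 0 < c by rewrite sqrtr_gt0.
  have -> : s = c ^+ 2 by rewrite sqr_sqrtr// ltW.
  have mslice := measurable_radius_pow_slice d.
  have slice_ge0 r t : (0 <= (radius_pow d (r - t ^+ 2))%:E)%E.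
    by rewrite lee_fin radius_pow_ge0.
  rewrite (ge0_integral_affine 0 c0)// preimage_setT.
  under eq_integral => t _.
    rewrite addr0 exprMn -[X in X - _]mulr1 -mulrBr radius_powZ// EFinM.
    over.
  rewrite ge0_integralZl_EFin ?exprn_ge0 ?ltW//; last exact: mslice.
  by rewrite radius_pow_sqr// muleA -EFinM -exprS muleC.
- rewrite radius_powS0 mule0 -(integral_set1
    (fun t => (radius_pow d (0 - t ^+ 2))%:E) 0).
  rewrite [RHS]integral_mkcond; apply: eq_integral => t _.
  rewrite /patch; case: ifPn => //; rewrite notin_setE/= => /eqP t0.
  by rewrite radius_pow_lt0// sub0r oppr_lt0 exprn_even_gt0.
Qed.

Lemma ge0_integralZ_radius_pow d k s : 0 <= k ->
  (\int[mu]_t (k * radius_pow d (s - t ^+ 2))%:E =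
   (k * fine (slice_integral d) * radius_pow d.+1 s)%:E)%E.
Proof.
move=> k0; under eq_integral do rewrite EFinM.
rewrite ge0_integralZl_EFin//; last 2 first.
- by move=> t _; rewrite lee_fin radius_pow_ge0.
- exact: measurable_radius_pow_slice.
by rewrite integral_radius_pow -mulrA !EFinM fineK// slice_integral_fin_num.
Qed.

Definition ball_volume (d : nat) (s : R) : R := kappa R d * radius_pow d s.

Lemma ball_slice d t s :
  [set y : 'rV[R]_d | dotv (row_mx (\row_(k < 1) t) y)
     (row_mx (\row_(k < 1) t) y) <= s] = [set y | dotv y y <= s - t ^+ 2].
Proof.
by apply/seteqP; split=> y /=; rewrite dotv_row_mx dotv_dim1 !mxE lerBrDl.
Qed.

Lemma volume_ball d s :
  volume [set x : 'rV[R]_d | dotv x x <= s] = (ball_volume d s)%:E.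
Proof.
rewrite /ball_volume /kappa.
have -> : @unit_ball R d = [set x | dotv x x <= 1] by [].
elim: d s => [|d IHd] s /=.
  have dot0 : dotv (0 : 'rV[R]_0) 0 = 0 by rewrite /dotv big_ord0.
  rewrite dot0 !asboolb ler01/= mul1r /radius_pow expr0 mulr1.
  by case: (0 <= s).
set kd := fine _ in IHd.
have kd_ge0 : 0 <= kd by exact/fine_ge0/volume_ge0.
have slices r : (\int[mu]_t volume [set y : 'rV[R]_d |
    dotv (row_mx (\row_(k < 1) t) y) (row_mx (\row_(k < 1) t) y) <= r]%R =
    (kd * fine (slice_integral d) * radius_pow d.+1 r)%:E)%E.
  under eq_integral do rewrite ball_slice IHd.
  exact: ge0_integralZ_radius_pow.
by rewrite !slices/= radius_pow1 mulr1.
Qed.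

Lemma integral_ball_volume d s :
  (\int[mu]_t (ball_volume d (s - t ^+ 2))%:E = (ball_volume d.+1 s)%:E)%E.
Proof.
rewrite -volume_ball/=; apply: eq_integral => t _.
by rewrite ball_slice volume_ball.
Qed.

Lemma ball_volume_sqr d r : 0 < r ->
  ball_volume d (r ^+ 2) = kappa R d * r ^+ d.
Proof. by move=> r0; rewrite /ball_volume radius_pow_sqr. Qed.

Lemma kappa0 : kappa R 0 = 1.
Proof. by rewrite /kappa/= asboolT//= /unit_ball/= /dotv big_ord0. Qed.

Lemma kappaS d : kappa R d.+1 = kappa R d * fine (slice_integral d).
Proof.
have := integral_ball_volume d 1.
rewrite ge0_integralZ_radius_pow ?kappa_ge0// => -[].
by rewrite /ball_volume !radius_pow1 !mulr1.
Qed.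

Lemma kappa_gt0 d : 0 < kappa R d.
Proof.
elim: d => [|d IHd]; first by rewrite kappa0.
by rewrite kappaS mulr_gt0// fine_gt0// slice_integral_gt0 slice_integral_lty.
Qed.

Lemma ball_volume_ge0 d s : 0 <= ball_volume d s.
Proof. by rewrite mulr_ge0 ?kappa_ge0 ?radius_pow_ge0. Qed.

Lemma measurable_ball_volume_slice d s :
  measurable_fun [set: R] (fun t => (ball_volume d (s - t ^+ 2))%:E).
Proof.
apply/measurable_EFinP/measurable_funM => //; apply/measurable_EFinP.
exact: measurable_radius_pow_slice.
Qed.

End BallVolume.

Section BoxNeighbourhood.
Context {R : realType}.
Local Notation mu := (@lebesgue_measure R).

Definition box_nbhd n (a : 'rV[R]_n) (s : R) : set 'rV[R]_n :=
  [set z | let v := map2_mx dist_seg a z in dotv v v <= s].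

Lemma box_nbhd_slice n (a : 'rV[R]_1) (b : 'rV[R]_n) s t :
  [set y | box_nbhd (row_mx a b) s (row_mx (\row_(k < 1) t) y)] =
  box_nbhd b (s - dist_seg (a 0 0) t ^+ 2).
Proof.
by apply/seteqP; split=> y;
  rewrite /box_nbhd/= map2_row_mx dotv_row_mx dotv_dim1 !mxE lerBrDl.
Qed.

Lemma integral_ball_volume_dist_seg n (c : nat -> R) a s :
  (forall j, 0 <= c j) -> 0 <= a ->
  (\int[mu]_t (\sum_(j < n.+1)
     c j * ball_volume (n - j) (s - dist_seg a t ^+ 2))%:E =
   (2 * a * (\sum_(j < n.+1) c j * ball_volume (n - j) s) +
    \sum_(j < n.+1) c j * ball_volume (n.+1 - j) s)%:E)%E.
Proof.
move=> c0 a0.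
pose g (u : R) : \bar R :=
  (\sum_(j < n.+1) (c j)%:E * (ball_volume (n - j) (s - u ^+ 2))%:E)%E.
have term_ge0 j u : (0 <= (c j)%:E * (ball_volume (n - j) (s - u ^+ 2))%:E)%E.
  by rewrite mule_ge0 ?lee_fin ?ball_volume_ge0.
have mterm j : measurable_fun [set: R]
    (fun u => (c j)%:E * (ball_volume (n - j) (s - u ^+ 2))%:E)%E.
  by apply: emeasurable_funM => //; exact: measurable_ball_volume_slice.
have gE u : g u = (\sum_(j < n.+1) c j * ball_volume (n - j) (s - u ^+ 2))%:E.
  by rewrite -sumEFin; apply: eq_bigr => j _; rewrite EFinM.
have g_norm t : g `|t| = g t by rewrite !gE real_normK ?num_real.
under eq_integral do rewrite -gE.
rewrite ge0_integral_dist_seg//; last 2 first.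
- exact: emeasurable_sum.
- by move=> t; exact: sume_ge0.
under eq_integral do rewrite g_norm.
rewrite gE expr0n/= subr0 EFinD EFinM; congr (_ + _)%E.
rewrite ge0_integral_sum//; last by move=> j; exact: mterm.
rewrite -sumEFin; apply: eq_bigr => j _.
rewrite ge0_integralZl_EFin//; last 2 first.
- by move=> t _; rewrite lee_fin ball_volume_ge0.
- exact: measurable_ball_volume_slice.
by rewrite integral_ball_volume subSn// -ltnS.
Qed.

Lemma volume_box_nbhd n (a : 'rV[R]_n) s : (forall i, 0 <= a 0 i) ->
  volume (box_nbhd a s) =
  (\sum_(j < n.+1) elemsym j (2 *: a) * ball_volume (n - j) s)%:E.
Proof.
elim/rV_ind: a s => [a s _|{}n a b IHb s ab0].
  have -> : box_nbhd a s = [set x | dotv x x <= s].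
    by apply/seteqP; split=> x; rewrite /box_nbhd /dotv/= !big_ord0.
  by rewrite volume_ball big_ord1 elemsym0 mul1r.
have a0 : 0 <= a 0 0 by have := ab0 (lshift n 0); rewrite row_mxEl.
have b0 i : 0 <= b 0 i by have := ab0 (rshift 1 i); rewrite row_mxEr.
transitivity (\int[mu]_t volume [set y | box_nbhd (row_mx a b) s
  (row_mx (\row_(k < 1) t) y)])%E => //.
under eq_integral do rewrite box_nbhd_slice IHb//.
have elemsym_b0 j : 0 <= elemsym j (2 *: b).
  by apply: elemsym_ge0 => i; rewrite mxE mulr_ge0.
rewrite (integral_ball_volume_dist_seg n s elemsym_b0 a0).
congr EFin; rewrite [RHS]big_ord_recl/= elemsym0 mul1r subn0.
under [X in _ = _ + X]eq_bigr do rewrite scale_row_mx elemsym_cons mulrDl.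
rewrite big_split/= [X in _ = _ + (X + _)]big_ord_recr/= elemsym_gt// mul0r.
rewrite addr0 addrC big_ord_recl/= elemsym0 mul1r subn0 mulr_sumr -addrA.
congr (_ + (_ + _)); apply: eq_bigr => j _.
by rewrite mxE !subSS mulrA.
Qed.

End BoxNeighbourhood.

Section SteinerCoefficients.
Context {R : realType}.

Lemma steiner_coeffs_unique n (K : set 'rV[R]_n) (V W : nat -> R) j :
  (j <= n)%N -> steiner_coeffs K V -> steiner_coeffs K W -> V j = W j.
Proof.
move=> jn steinerV steinerW.
pose p := \poly_(k < n.+1) (kappa R k * (V (n - k)%N - W (n - k)%N)).
have p0 : p = 0.
  apply: gt0_roots_poly_eq0 => r r0.
  have /eqP := steinerV r r0; rewrite steinerW// eqe eq_sym -subr_eq0 -sumrB.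
  move=> /eqP sum0; rewrite -[RHS]sum0 horner_poly (reindex_inj rev_ord_inj)/=.
  by apply: eq_bigr => i _; rewrite subSS subKn -1?ltnS//; ring.
have /eqP : p`_(n - j) = 0 by rewrite p0 coef0.
rewrite coef_poly ltnS leq_subr subKn// mulf_eq0 gt_eqF ?kappa_gt0//=.
by rewrite subr_eq0 => /eqP.
Qed.

Lemma intrinsic_volumeE n (K : set 'rV[R]_n) (V : nat -> R) j :
  (j <= n)%N -> steiner_coeffs K V -> intrinsic_volume K j = V j.
Proof.
move=> jn steinerV; apply: (steiner_coeffs_unique jn _ steinerV).
exact: (ClassicalEpsilon.epsilon_spec (inhabits _) _ (ex_intro _ _ steinerV)).
Qed.

End SteinerCoefficients.

Section Boxes.
Context {R : realType}.

Definition box n (a : 'rV[R]_n) : set 'rV[R]_n :=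
  [set x | forall i, `|x 0 i| <= a 0 i].

Lemma convex_box n (a : 'rV[R]_n) : Defs.convex_set (box a).
Proof.
move=> x y t xa ya /andP[t0 t1] i; rewrite !mxE.
have t'0 : 0 <= 1 - t by rewrite subr_ge0.
apply: le_trans (ler_normD _ _) _.
rewrite !normrM (ger0_norm t0) (ger0_norm t'0).
have -> : a 0 i = t * a 0 i + (1 - t) * a 0 i by ring.
by rewrite lerD// ler_wpM2l.
Qed.

Lemma origin_symmetric_box n (a : 'rV[R]_n) : origin_symmetric (box a).
Proof. by move=> x xa i; rewrite mxE normrN. Qed.

Lemma compact_box n (a : 'rV[R]_n) : compact (box a).
Proof.
pose side i := `[- a 0 i, a 0 i]%classic.
have -> : box a = [set x : 'rV_n | forall i, side i (x 0 i)].
  apply/seteqP; split=> x /= xa i; have := xa i.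
    by rewrite /side/= in_itv/= ler_norml.
  by rewrite /side/= in_itv/= ler_norml.
by apply: rV_compact => i; exact: segment_compact.
Qed.

Lemma convex_body_box n (a : 'rV[R]_n) :
  (forall i, 0 < a 0 i) -> convex_body (box a).
Proof.
move=> a0; split; [exact: convex_box | split; first exact: compact_box].
exists 0; pose e := \big[Num.min/1]_(i < n) a 0 i.
have e0 : 0 < e.
  by rewrite /e; elim/big_ind : _ => // x y x0 y0; rewrite lt_min x0.
apply/nbhs_ballP; exists e => //= x [_ xe] i.
have /ltW/le_trans := xe 0 i; rewrite mxE sub0r normrN; apply.
by rewrite /e (bigD1 i)//= ge_min lexx.
Qed.

Lemma parallel_body_box n (a : 'rV[R]_n) rho : (forall i, 0 <= a 0 i) ->
  0 < rho -> parallel_body (box a) rho = box_nbhd a (rho ^+ 2).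
Proof.
move=> a0 rho0; apply/seteqP; split=> [_ [x [b [xa [b1 ->]]]]|z az].
  apply: (@le_trans _ _ (dotv (rho *: b) (rho *: b))); last first.
    by rewrite dotvZ ler_piMr ?sqr_ge0.
  apply: ler_sum => i _; rewrite mxE [(x + _) _ _]mxE.
  rewrite -!expr2 -[leRHS]real_normK ?num_real//.
  by rewrite lerXn2r ?nnegrE ?dist_seg_ge0// dist_seg_le.
pose x := map2_mx clamp a z.
exists x, (rho^-1 *: (z - x)); split; first by move=> i; rewrite mxE norm_clamp.
split; last by rewrite scalerA divff ?gt_eqF// scale1r addrC subrK.
rewrite /unit_ball/= dotvZ exprVn ler_pdivrMl ?exprn_gt0// mulr1.
set v := map2_mx dist_seg a z; suff -> : dotv (z - x) (z - x) = dotv v v by [].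
by apply: eq_bigr => i _; rewrite !mxE -!expr2 sqr_sub_clamp.
Qed.

Lemma intrinsic_volume_box n (a : 'rV[R]_n) j : (forall i, 0 <= a 0 i) ->
  (j <= n)%N -> intrinsic_volume (box a) j = 2 ^+ j * elemsym j a.
Proof.
move=> a0 jn; rewrite -elemsymZ.
apply: (intrinsic_volumeE (V := fun j => elemsym j (2 *: a))) => // rho rho0.
rewrite parallel_body_box// volume_box_nbhd//; congr EFin.
by apply: eq_bigr => i _; rewrite ball_volume_sqr//; ring.
Qed.

Lemma support_fun_box n (a u : 'rV[R]_n) : (forall i, 0 <= a 0 i) ->
  support_fun (box a) u = dotv a (map_mx Num.norm u).
Proof.
move=> a0; set S := [set dotv u y | y in box a].
have ubS : ubound S (dotv a (map_mx Num.norm u)).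
  move=> _ [y ya <-]; apply: ler_sum => i _; rewrite mxE.
  by apply: le_trans (ler_norm _) _; rewrite normrM mulrC ler_wpM2r.
have inS : S (dotv a (map_mx Num.norm u)).
  exists (\row_i (a 0 i * Num.sg (u 0 i))).
    move=> i; rewrite mxE normrM ger0_norm// ler_piMr// normr_sg.
    by case: (_ == 0).
  by apply: eq_bigr => i _; rewrite !mxE mulrCA (mulrC (u 0 i)) -normrEsg.
apply/eqP; rewrite eq_le ge_sup//=; last by eexists; exact: inS.
by apply: ub_le_sup => //; eexists; exact: ubS.
Qed.

End Boxes.

Section LpMean.
Context {R : realType}.
Implicit Types (p lam x y : R).

Lemma gt1r_powR x p : 0 < x < 1 -> 1 < p -> x `^ p < x.
Proof.
rewrite -(subr_gt0 1 p) => /andP[x0 x1] p1.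
have -> : x `^ p = x * x `^ (p - 1) by rewrite mulr_powRB1 ?ltW//; lra.
have : x `^ (p - 1) < 1 `^ (p - 1) by rewrite gt0_ltr_powR ?nnegrE// ltW.
by rewrite powR1 gtr_pMr.
Qed.

Lemma continuous_powR p x : 0 < x -> {for x, continuous (@powR R ^~ p)}.
Proof.
move=> x0; apply/differentiable_continuous/derivable1_diffP.
by apply: derivable_powR; rewrite in_itv/= x0.
Qed.

Lemma powR_amgm lam x y : 0 < lam < 1 -> 0 <= x -> 0 <= y ->
  x `^ (1 - lam) * y `^ lam <= (1 - lam) * x + lam * y.
Proof.
rewrite -(subr_gt0 lam) => /andP[lam0 lam1] x0 y0.
have := conjugate_powR (powR_ge0 x (1 - lam)) (powR_ge0 y lam).
move=> /(_ (1 - lam)^-1 lam^-1).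
rewrite !invr_gt0 !invrK subrK => /(_ lam1 lam0 erefl).
by rewrite -!powRrM !divff ?gt_eqF// !powRr1// (mulrC x) (mulrC y).
Qed.

Definition Lp_mean p lam x y : R :=
  if p == 0 then x `^ (1 - lam) * y `^ lam
  else ((1 - lam) * x `^ p + lam * y `^ p) `^ p^-1.

Lemma Lp_mean0E lam x y : Lp_mean 0 lam x y = x `^ (1 - lam) * y `^ lam.
Proof. by rewrite /Lp_mean eqxx. Qed.

Lemma Lp_meanE p (pn0 : p != 0) lam x y :
  Lp_mean p lam x y = ((1 - lam) * x `^ p + lam * y `^ p) `^ p^-1.
Proof. by rewrite /Lp_mean (negbTE pn0). Qed.

Lemma Lp_mean_ge0 p lam x y : 0 <= Lp_mean p lam x y.
Proof.
by rewrite /Lp_mean; case: ifP => _; rewrite ?powR_ge0// mulr_ge0 ?powR_ge0.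
Qed.

Lemma Lp_mean_id p lam x : 0 <= x -> Lp_mean p lam x x = x.
Proof.
move=> x0; have [->|pn0] := eqVneq p 0.
  by rewrite Lp_mean0E -powRD subrK ?powRr1// oner_eq0.
by rewrite (Lp_meanE pn0) -mulrDl subrK mul1r -powRrM divff// powRr1.
Qed.

Lemma Lp_meanC p lam x y : Lp_mean p lam x y = Lp_mean p (1 - lam) y x.
Proof.
by rewrite /Lp_mean subKr (mulrC (y `^ _)) (addrC (lam * _)).
Qed.

Lemma wsum_powR_ge0 p lam x y : 0 < lam < 1 ->
  0 <= (1 - lam) * x `^ p + lam * y `^ p.
Proof.
by case/andP=> lam0 lam1; rewrite addr_ge0// mulr_ge0 ?powR_ge0 ?subr_ge0// ltW.
Qed.

Section Weight.
Variable lam : R.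
Hypothesis lam01 : 0 < lam < 1.

Let lam_gt0 : 0 < lam. Proof. by case/andP: lam01. Qed.
Let onem_gt0 : 0 < 1 - lam. Proof. by rewrite subr_gt0; case/andP: lam01. Qed.

Lemma ler_Lp_mean p x y x' y' : 0 <= p -> 0 <= x <= x' -> 0 <= y <= y' ->
  Lp_mean p lam x y <= Lp_mean p lam x' y'.
Proof.
move=> p0 /andP[x0 xx'] /andP[y0 yy'].
have powR_le q z z' : 0 <= q -> 0 <= z -> z <= z' -> z `^ q <= z' `^ q.
  by move=> q0 z0 zz'; rewrite ge0_ler_powR ?nnegrE// (le_trans z0).
have [->|pn0] := eqVneq p 0.
  by rewrite !Lp_mean0E ler_pM ?powR_ge0 ?powR_le// ltW.
rewrite !(Lp_meanE pn0) powR_le ?invr_ge0 ?wsum_powR_ge0//.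
by rewrite lerD// ler_wpM2l ?powR_le// ltW.
Qed.

(* [1 - th] and [th] are the weights of [x / a] and [y / b] in the tangent plane
   of the mean at [(a, b)]. *)
Lemma Lp_mean_rescale p a b : 0 < a -> 0 < b ->
  exists2 th, 0 < th < 1 & forall x y, 0 <= x -> 0 <= y ->
    Lp_mean p lam x y = Lp_mean p lam a b * Lp_mean p th (x / a) (y / b).
Proof.
move=> a0 b0; have [a_ge0 b_ge0] := (ltW a0, ltW b0).
pose s := (1 - lam) * a `^ p + lam * b `^ p; pose th := lam * b `^ p / s.
have wa0 : 0 < (1 - lam) * a `^ p by rewrite mulr_gt0// powR_gt0.
have wb0 : 0 < lam * b `^ p by rewrite mulr_gt0// powR_gt0.
have s0 : 0 < s by exact: addr_gt0.
have th01 : 0 < th < 1 by rewrite divr_gt0//= ltr_pdivrMr// mul1r ltrDr.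
exists th => // x y x0 y0.
have [u u0 ->] : exists2 u, 0 <= u & x = a * u.
  by exists (x / a); rewrite ?divr_ge0// mulrCA divff ?mulr1// gt_eqF.
have [v v0 ->] : exists2 v, 0 <= v & y = b * v.
  by exists (y / b); rewrite ?divr_ge0// mulrCA divff ?mulr1// gt_eqF.
rewrite !(mulrAC _ _ _^-1) !divff ?gt_eqF// !mul1r.
have [p0|pn0] := eqVneq p 0.
  rewrite /th /s p0 !powRr0 !mulr1 subrK divr1 !Lp_mean0E !powRM//.
  exact: mulrACA.
have lamE : lam * b `^ p = s * th by rewrite [RHS]mulrC divfK// gt_eqF.
have onemE : (1 - lam) * a `^ p = s * (1 - th).
  by rewrite mulrBr mulr1 -lamE addrK.
have sumE : (1 - lam) * (a * u) `^ p + lam * (b * v) `^ p =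
    s * ((1 - th) * u `^ p + th * v `^ p).
  by rewrite !powRM// !mulrA lamE onemE -!mulrA -mulrDr.
by rewrite !(Lp_meanE pn0) sumE powRM ?wsum_powR_ge0// ltW.
Qed.

Lemma Lp_meanZ p c x y : 0 <= c -> 0 <= x -> 0 <= y ->
  Lp_mean p lam (c * x) (c * y) = c * Lp_mean p lam x y.
Proof.
move=> c0 x0 y0; rewrite -[in RHS](Lp_mean_id p lam c0).
have [->|pn0] := eqVneq p 0.
  by rewrite !Lp_mean0E !powRM// mulrACA.
rewrite !(Lp_meanE pn0) -mulrDl subrK mul1r -powRM ?powR_ge0 ?wsum_powR_ge0//.
by rewrite (powRM _ c0 x0) (powRM _ c0 y0) mulrDr !(mulrCA (c `^ p)).
Qed.

Lemma Lp_mean_le_amean p x y : 0 <= p <= 1 -> 0 <= x -> 0 <= y ->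
  Lp_mean p lam x y <= (1 - lam) * x + lam * y.
Proof.
move=> /andP[p0 p1] x0 y0; have [->|pn0] := eqVneq p 0.
  by rewrite Lp_mean0E powR_amgm.
have pV1 : 1 <= p^-1 by rewrite invf_ge1// lt_neqAle eq_sym pn0.
have lam1 : lam <= 1 by rewrite -subr_ge0 ltW.
have : (lam * y `^ p + (1 - lam) * x `^ p) `^ p^-1 <=
    lam * (y `^ p) `^ p^-1 + (1 - lam) * (x `^ p) `^ p^-1.
  have := convex_powR pV1 (Itv01 (ltW lam_gt0) lam1).
  move=> /(_ (y `^ p) (x `^ p)); rewrite !convRE; apply.
    by rewrite inE/= in_itv/= andbT powR_ge0.
  by rewrite inE/= in_itv/= andbT powR_ge0.
by rewrite -!powRrM divff// !powRr1// (Lp_meanE pn0) addrC [leRHS]addrC.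
Qed.

Lemma Lp_mean0_le p x y : 0 <= p -> 0 <= x -> 0 <= y ->
  Lp_mean 0 lam x y <= Lp_mean p lam x y.
Proof.
move=> p0 x0 y0; have [->//|pn0] := eqVneq p 0.
have powRVK q z : ((z `^ p) `^ q) `^ p^-1 = z `^ q.
  by rewrite -!powRrM mulrCA divff// mulr1.
have -> : Lp_mean 0 lam x y = (Lp_mean 0 lam (x `^ p) (y `^ p)) `^ p^-1.
  rewrite !Lp_mean0E -(powRVK (1 - lam) x) -(powRVK lam y).
  exact: esym (powRM _ (powR_ge0 _ _) (powR_ge0 _ _)).
rewrite [leRHS](Lp_meanE pn0).
apply: ge0_ler_powR; rewrite ?nnegrE ?invr_ge0 ?Lp_mean_ge0 ?wsum_powR_ge0//.
by rewrite Lp_mean0E powR_amgm ?powR_ge0.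
Qed.

End Weight.

(* Rescaled by their sums the terms are below their weighted arithmetic means,
   which add up to [1]. *)
Lemma sum_Lp_mean_le p lam (I : finType) (f g : I -> R) :
  0 <= p <= 1 -> 0 < lam < 1 -> (forall i, 0 <= f i) -> (forall i, 0 <= g i) ->
  \sum_i Lp_mean p lam (f i) (g i) <= Lp_mean p lam (\sum_i f i) (\sum_i g i).
Proof.
move=> p01 lam01 f0 g0.
have Lp_mean0l y : 0 <= y -> Lp_mean p lam 0 y = y * Lp_mean p lam 0 1.
  by move=> y0; have := Lp_meanZ lam01 p y0 (lexx 0) ler01; rewrite mulr0 mulr1.
have Lp_mean0r x : 0 <= x -> Lp_mean p lam x 0 = x * Lp_mean p lam 1 0.
  by move=> x0; have := Lp_meanZ lam01 p x0 ler01 (lexx 0); rewrite mulr0 mulr1.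
have [F0|Fn0] := eqVneq (\sum_i f i) 0.
  have f_eq0 i : f i = 0 by exact: (psumr_eq0P (fun i _ => f0 i) F0).
  rewrite F0 Lp_mean0l ?sumr_ge0// mulr_suml.
  by apply: ler_sum => i _; rewrite f_eq0 Lp_mean0l.
have [G0|Gn0] := eqVneq (\sum_i g i) 0.
  have g_eq0 i : g i = 0 by exact: (psumr_eq0P (fun i _ => g0 i) G0).
  rewrite G0 Lp_mean0r ?sumr_ge0// mulr_suml.
  by apply: ler_sum => i _; rewrite g_eq0 Lp_mean0r.
move: Fn0 Gn0; set F := \sum_i f i; set G := \sum_i g i => Fn0 Gn0.
have F_gt0 : 0 < F by rewrite lt0r Fn0 sumr_ge0.
have G_gt0 : 0 < G by rewrite lt0r Gn0 sumr_ge0.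
have [th th01 rescale] := Lp_mean_rescale lam01 p F_gt0 G_gt0.
have term_le i : Lp_mean p lam (f i) (g i) <=
    Lp_mean p lam F G * ((1 - th) * (f i / F) + th * (g i / G)).
  have fF0 : 0 <= f i / F by rewrite divr_ge0// ltW.
  have gG0 : 0 <= g i / G by rewrite divr_ge0// ltW.
  rewrite rescale//; apply: ler_wpM2l; first exact: Lp_mean_ge0.
  exact: Lp_mean_le_amean.
apply: le_trans (ler_sum _ (fun i _ => term_le i)) _.
rewrite -mulr_sumr big_split/= -!mulr_sumr -!mulr_suml !divff//.
by rewrite !mulr1 subrK mulr1.
Qed.

Section MeanNearTheAxis.
Variables p lam : R.
Hypotheses (p01 : 0 <= p < 1) (lam01 : 0 < lam < 1).

Lemma Lp_mean10_lt : Lp_mean p lam 1 0 < 1 - lam.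
Proof.
have /andP[p0 p1] := p01; have /andP[lam0 lam1] := lam01.
have [->|pn0] := eqVneq p 0.
  by rewrite Lp_mean0E powR0 ?mulr0 ?subr_gt0// gt_eqF.
rewrite (Lp_meanE pn0) powR0// powR1 mulr1 mulr0 addr0.
by apply: gt1r_powR; rewrite ?invf_gt1 ?lt0r ?pn0//; apply/andP; split; lra.
Qed.

Lemma cvg_Lp_mean_at_right0 x : 0 < x ->
  Lp_mean p lam x r @[r --> 0^'+] --> Lp_mean p lam x 0.
Proof.
move=> x0; have /andP[p0 p1] := p01; have /andP[lam0 lam1] := lam01.
have [->|pn0] := eqVneq p 0.
  under eq_fun do rewrite Lp_mean0E; rewrite Lp_mean0E powR0 ?gt_eqF//.
  by apply: cvgM; [exact: cvg_cst | exact: powR_cvg0].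
have p_gt0 : 0 < p by rewrite lt0r pn0.
under eq_fun do rewrite (Lp_meanE pn0); rewrite (Lp_meanE pn0) powR0//.
have wsum_cvg : (1 - lam) * x `^ p + lam * r `^ p @[r --> 0^'+] -->
    (1 - lam) * x `^ p + lam * 0.
  apply: cvgD; first exact: cvg_cst.
  by apply: cvgM; [exact: cvg_cst | exact: powR_cvg0].
have cont := @continuous_powR p^-1 ((1 - lam) * x `^ p + lam * 0).
apply: (continuous_cvg _ (cont _) wsum_cvg).
by rewrite mulr0 addr0 mulr_gt0 ?subr_gt0// powR_gt0.
Qed.

End MeanNearTheAxis.

Definition spike n (i : 'I_n) (r : R) : 'rV[R]_n :=
  \row_k (if k == i then 1 else r).

Lemma spike_gt0 n (i : 'I_n) r k : 0 < r -> 0 < spike i r 0 k.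
Proof. by move=> r0; rewrite mxE; case: ifP. Qed.

Lemma sum_spike_ge1 n (i : 'I_n) r : 0 <= r -> 1 <= \sum_k spike i r 0 k.
Proof.
move=> r0; rewrite (bigD1 i)//= mxE eqxx lerDl sumr_ge0// => k _.
by rewrite mxE; case: ifP.
Qed.

Lemma near_sum_Lp_mean_spike_lt1 p lam n (i j : 'I_n) :
  0 <= p < 1 -> 0 < lam < 1 -> i != j ->
  \forall r \near 0^'+,
    \sum_k Lp_mean p lam (spike i r 0 k) (spike j r 0 k) < 1.
Proof.
move=> p01 lam01 ij; have ji : j != i by rewrite eq_sym.
have onem01 : 0 < 1 - lam < 1.
  by case/andP: lam01 => lam0 lam1; apply/andP; split; lra.
pose c : R := \sum_(k < n | (k != i) && (k != j)) 1.
have sumE : \forall r \near 0^'+,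
    Lp_mean p lam 1 r + (Lp_mean p (1 - lam) 1 r + r * c) =
    \sum_k Lp_mean p lam (spike i r 0 k) (spike j r 0 k).
  near=> r; rewrite (bigD1 i)//= (bigD1 j)//= !mxE !eqxx.
  rewrite (negbTE ij) (negbTE ji) [in RHS](Lp_meanC _ _ r) mulr_sumr.
  congr (_ + (_ + _)).
  apply: eq_bigr => k /andP[/negbTE ki /negbTE kj].
  by rewrite !mxE ki kj Lp_mean_id// mulr1.
have lim : Lp_mean p lam 1 r + (Lp_mean p (1 - lam) 1 r + r * c) @[r --> 0^'+]
    --> Lp_mean p lam 1 0 + (Lp_mean p (1 - lam) 1 0 + 0 * c).
  apply: cvgD; first exact: cvg_Lp_mean_at_right0.
  apply: cvgD; first exact: cvg_Lp_mean_at_right0.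
  by apply: cvgM; [apply: cvg_at_right_filter; exact: cvg_id | exact: cvg_cst].
have lim_lt1 : Lp_mean p lam 1 0 + (Lp_mean p (1 - lam) 1 0 + 0 * c) < 1.
  have := Lp_mean10_lt p01 onem01; have := Lp_mean10_lt p01 lam01.
  by rewrite subKr mul0r addr0; lra.
near=> r; rewrite -(near sumE)//.
by near: r; exact: (cvgr_lt _ lim).
Unshelve. all: by end_near. Qed.

End LpMean.

Lemma Lp_combE (R : realType) n p lam (K L : set 'rV[R]_n) :
  Lp_comb p lam K L =
  wulff (fun u => Lp_mean p lam (support_fun K u) (support_fun L u)).
Proof. by rewrite /Lp_comb /Lp_mean; case: (p == 0). Qed.

Lemma Lp_comb_box (R : realType) n p lam (a b : 'rV[R]_n) :
  0 <= p <= 1 -> 0 < lam < 1 ->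
  (forall i, 0 <= a 0 i) -> (forall i, 0 <= b 0 i) ->
  Lp_comb p lam (box a) (box b) = box (map2_mx (Lp_mean p lam) a b).
Proof.
move=> p01 lam01 a0 b0; rewrite Lp_combE.
apply/seteqP; split=> [x xW i|x xab u _].
  rewrite mxE; set s : R := (-1) ^+ (x 0 i < 0)%R.
  have norm_s : `|s| = 1 by exact: normr_sign.
  have norm_u :
      map_mx Num.norm (s *: delta_mx 0 i) = 1 *: delta_mx 0 i :> 'rV_n.
    by apply/rowP => k; rewrite !mxE normrM norm_s normr_nat.
  have := xW (s *: delta_mx 0 i); rewrite !support_fun_box// norm_u !dotv_delta.
  rewrite !mul1r -normrEsign; apply.
  rewrite /unit_sphere/= dotv_delta !mxE !eqxx.
  by rewrite mulr1 -expr2 sqrr_sign.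
rewrite !support_fun_box//.
apply: le_trans (sum_Lp_mean_le p01 lam01 _ _) => [|i|i]; last 2 first.
- by rewrite mxE mulr_ge0.
- by rewrite mxE mulr_ge0.
apply: ler_sum => i _; rewrite !mxE 2!(mulrC _ `|u 0 i|) Lp_meanZ//.
apply: le_trans (ler_norm _) _; rewrite normrM mulrC ler_wpM2l//.
by have := xab i; rewrite mxE.
Qed.

Lemma map2_Lp_mean_pad1 (R : realType) p lam k n (u v : 'rV[R]_n) d :
  0 < lam < 1 -> 0 <= d -> (forall i, 0 <= u 0 i) -> (forall i, 0 <= v 0 i) ->
  map2_mx (Lp_mean p lam) (pad1 k (d *: u)) (pad1 k (d *: v)) =
  pad1 k (d *: map2_mx (Lp_mean p lam) u v).
Proof.
move=> lam01 d0 u0 v0; rewrite map2_row_mx map2_const_mx Lp_mean_id//.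
by congr row_mx; apply/rowP => i; rewrite !mxE Lp_meanZ.
Qed.

Lemma exists_elemsym_Lp_mean_lt (R : realType) (p lam : R) k m :
  0 <= p < 1 -> 0 < lam < 1 ->
  exists a b : 'rV[R]_(k + m.+2), exists2 d, 0 < d &
    [/\ forall i, 0 < a 0 i, forall i, 0 < b 0 i,
        d <= elemsym k.+1 a, d <= elemsym k.+1 b &
        elemsym k.+1 (map2_mx (Lp_mean p lam) a b) < d].
Proof.
move=> p01 lam01; pose i : 'I_m.+2 := ord0; pose j : 'I_m.+2 := ord_max.
have sum_near := near_sum_Lp_mean_spike_lt1 p01 lam01 (isT : i != j).
have [r [r0 sum_lt1]] := filter_ex (filterI (nbhs_right_gt 0) sum_near).
pose u := spike i r; pose v := spike j r.
have u0 l : 0 < u 0 l by exact: spike_gt0.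
have v0 l : 0 < v 0 l by exact: spike_gt0.
have mean_sum_lt1 : \sum_l map2_mx (Lp_mean p lam) u v 0 l < 1.
  by under eq_bigr do rewrite mxE; exact: sum_lt1.
have mean_near := near_elemsym_pad1_lt k mean_sum_lt1.
have [d [d0 mean_lt]] := filter_ex (filterI (nbhs_right_gt 0) mean_near).
have ge_d l : d <= elemsym k.+1 (pad1 k (d *: spike l r)).
  apply: le_trans (elemsym_pad1_ge _ _ (ltW d0)) => [|h].
    by rewrite ler_peMr ?sum_spike_ge1// ltW.
  by rewrite ltW// spike_gt0.
exists (pad1 k (d *: u)), (pad1 k (d *: v)), d => //; split.
- by apply: pad1_gt0 => l; rewrite mxE mulr_gt0.
- by apply: pad1_gt0 => l; rewrite mxE mulr_gt0.
- exact: ge_d.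
- exact: ge_d.
- rewrite map2_Lp_mean_pad1 ?(ltW d0)// => [|l|l]; try exact: ltW.
  by move: mean_lt; rewrite mulr1.
Qed.

Lemma exists_box_intrinsic_volume_lt (R : realType) n j (p lam : R) :
  (0 < j < n)%N -> 0 <= p < 1 -> 0 < lam < 1 ->
  exists a b : 'rV[R]_n, exists2 c, 0 < c &
    [/\ forall i, 0 < a 0 i, forall i, 0 < b 0 i,
        c <= intrinsic_volume (box a) j, c <= intrinsic_volume (box b) j &
        intrinsic_volume (Lp_comb p lam (box a) (box b)) j < c].
Proof.
case: j => // k kn p01 lam01; have /andP[p0 /ltW p1] := p01.
have [m nE] : exists m, n = (k + m.+2)%N by exists (n - k.+2)%N; lia.
subst n; have k_lt_n : (k < k + m.+2)%N by lia.
have [a [b [d d0 [a0 b0 da db mean_lt]]]] :=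
  exists_elemsym_Lp_mean_lt k m p01 lam01.
have a_ge0 i : 0 <= a 0 i by exact: ltW.
have b_ge0 i : 0 <= b 0 i by exact: ltW.
have mean_ge0 i : 0 <= map2_mx (Lp_mean p lam) a b 0 i.
  by rewrite mxE Lp_mean_ge0.
have pow2_gt0 : 0 < 2 ^+ k.+1 :> R by rewrite exprn_gt0.
exists a, b, (2 ^+ k.+1 * d); first exact: mulr_gt0.
rewrite Lp_comb_box ?p0// !intrinsic_volume_box//.
by rewrite !(ler_pM2l pow2_gt0) (ltr_pM2l pow2_gt0).
Qed.

Theorem theorem1p1 (R : realType) (n j : nat) (p lam : R) :
  (3 <= n)%N -> (2 <= j <= n.-1)%N -> 0 <= p < 1 -> 0 < lam < 1 ->
  exists K L : set 'rV[R]_n,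
    [/\ convex_body K, convex_body L, origin_symmetric K, origin_symmetric L &
       (
        intrinsic_volume (Lp_comb p lam K L) j
          < intrinsic_volume K j `^ (1 - lam) * intrinsic_volume L j `^ lam
      /\ intrinsic_volume K j `^ (1 - lam) * intrinsic_volume L j `^ lam
          <= (if p == 0 then
                intrinsic_volume K j `^ (1 - lam) * intrinsic_volume L j `^ lam
              else
                ((1 - lam) * intrinsic_volume K j `^ (p / j%:R)
                 + lam * intrinsic_volume L j `^ (p / j%:R)) `^ (j%:R / p)))].
Proof.
move=> _ /andP[j2 jn] p01 lam01; have jn01 : (0 < j < n)%N by lia.
have [a [b [c c0 [a0 b0 cK cL comb_lt]]]] :=
  exists_box_intrinsic_volume_lt jn01 p01 lam01.
exists (box a), (box b); split; [exact: convex_body_box..|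
  exact: origin_symmetric_box|exact: origin_symmetric_box|].
have c_ge0 := ltW c0; rewrite -!Lp_mean0E; split.
  apply: lt_le_trans comb_lt _.
  by rewrite -[leLHS](Lp_mean_id 0 lam c_ge0) ler_Lp_mean// c_ge0.
have pj0 : 0 <= p / j%:R by case/andP: p01 => p0 _; rewrite divr_ge0.
have := Lp_mean0_le lam01 pj0 (le_trans c_ge0 cK) (le_trans c_ge0 cL).
have j0 : j%:R != 0 :> R by rewrite pnatr_eq0 -lt0n; case/andP: jn01.
by rewrite /Lp_mean mulf_eq0 invr_eq0 (negbTE j0) orbF eqxx invf_div.
Qed.
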